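(* Let $\Delta$ be a connected non-complete strongly regular graph with parameters $(v,k,\lambda,\mu)$, with adjacency matrix $A$ and non-principal eigenvalues $r>s$, and let $x\in\operatorname{Aut}(\Delta)$ have prime order $p$, with fixed vertex set $\mathcal F$. Fix $\theta\in\{r,s\}$, let $\theta'$ be the other element of $\{r,s\}$, and let $$E_\theta=\frac{A-\theta' I-\frac{k-\theta'}{v}J}{\theta-\theta'}=\alpha_\theta I+\beta_\theta A+\gamma_\theta J$$ with $\alpha_\theta,\beta_\theta,\gamma_\theta\in\mathbb Q(\theta)$ be the spectral idempotent of $A$ for $\theta$. Let $K$ be a finite extension of $\mathbb Q_p$ containing $\alpha_\theta,\beta_\theta,\gamma_\theta$, and let $O$ be its ring of integers, with maximal ideal $\mathfrak m$ and residue field $\kappa$. Assume that $E_\theta$ preserves the lattice $O^{V(\Delta)}$ (equivalently, that the entries of $E_\theta$ lie in $O$). Then $$\alpha_\theta\,a_0(x)+\beta_\theta\,a_1(x)+\gamma_\theta\,v=\operatorname{rank}_{\kappa}\bigl((\alpha_\theta I_{\mathcal F}+\beta_\theta A_{\mathcal F}+\gamma_\theta J_{\mathcal F})\bmod\mathfrak m\bigr).$$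
   Context: A strongly regular graph with parameters $(v,k,\lambda,\mu)$ is a finite simple $k$-regular graph on $v$ vertices in which any two adjacent vertices have exactly $\lambda$ common neighbours and any two distinct non-adjacent vertices have exactly $\mu$ common neighbours. Its non-principal eigenvalues are $r,s=\frac{(\lambda-\mu)\pm\sqrt{(\lambda-\mu)^2+4(k-\mu)}}{2}$, with $r>s$. $J$ is the all-one matrix and $I$ the identity matrix. $I_{\mathcal F},A_{\mathcal F},J_{\mathcal F}$ are the principal submatrices of $I,A,J$ on the rows and columns indexed by $\mathcal F$. $a_0(x)$ is the number of vertices fixed by $x$, and $a_1(x)=|\{u\in V(\Delta):u\sim x(u)\}|$ is the number of vertices adjacent to their image under $x$. The field $\mathbb Q(\theta)$ is regarded as embedded in $K$. The integer on the right-hand side of the identity is regarded as an element of $K$; an empty matrix has rank $0$. *)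

(* Defs.v *)
From HB Require Import structures.
From mathcomp Require Import all_boot all_order all_fingroup all_algebra.
From mathcomp Require Import all_field.
From mathcomp Require Import boolp.

Set Implicit Arguments.
Unset Strict Implicit.
Unset Printing Implicit Defensive.

Import Order.TTheory GRing.Theory Num.Theory.
Local Open Scope ring_scope.

(* An element of the inverse limit of the rings Z/p^n: [x n] is the           *)
(* representative in [0, p^n) of the component in Z/p^n (the condition        *)
(* includes this reducedness, being an equality of integers).                 *)
Definition padic_coherent (p : nat) (x : nat -> int) : bool :=
  `[< forall n, (x n.+1 %% (p ^ n)%N)%Z = x n >].

Lemma dvdz_pexp (p m n : nat) : (m <= n)%N -> (Posz (p ^ m) %| Posz (p ^ n))%Z.
Proof. by move=> mn; rewrite dvdzE /= dvdn_exp2l. Qed.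

Lemma modz_dvd_mod (a d e : int) :
  (d %| e)%Z -> ((a %% e)%Z %% d)%Z = (a %% d)%Z.
Proof.
move=> de; apply/eqP; rewrite eqz_mod_dvd; apply: (dvdz_trans de).
by rewrite -eqz_mod_dvd modz_mod.
Qed.

Record padic_int (p : nat) (p_pr : prime p) := PadicInt {
  padic_comp :> nat -> int;
  _ : padic_coherent p padic_comp }.

Section PadicInt.
Variables (p : nat) (p_pr : prime p).
Local Notation Zp := (padic_int p_pr).
Implicit Types x y z : Zp.

HB.instance Definition _ := [isSub for @padic_comp p p_pr].
HB.instance Definition _ := [Choice of Zp by <:].

Lemma padic_compS x n : (x n.+1 %% (p ^ n)%N)%Z = x n.
Proof. by case: x => x /= /asboolP. Qed.

Lemma padic_comp_mod x n : (x n %% (p ^ n)%N)%Z = x n.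
Proof. by rewrite -padic_compS modz_mod. Qed.

Lemma padic_eq x y : (forall n, x n = y n) -> x = y.
Proof. by move=> xy; apply/val_inj/funext. Qed.

Lemma padic_red_subproof (f : nat -> int) :
    (forall n, (f n.+1 = f n %[mod (p ^ n)%N])%Z) ->
  padic_coherent p (fun n => (f n %% (p ^ n)%N)%Z).
Proof.
move=> fP; apply/asboolP => n; rewrite modz_dvd_mod ?fP //.
exact: dvdz_pexp.
Qed.

Definition padic_red (f : nat -> int)
    (fP : forall n, (f n.+1 = f n %[mod (p ^ n)%N])%Z) : Zp :=
  PadicInt p_pr (padic_red_subproof fP).

Fact padic_const_subproof (a : int) n :
  ((fun=> a) n.+1 = (fun=> a) n %[mod (p ^ n)%N])%Z.
Proof. by []. Qed.

Fact padic_opp_subproof x n :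
  (- x n.+1 = - x n %[mod (p ^ n)%N])%Z.
Proof. by rewrite -modzNm padic_compS. Qed.

Fact padic_add_subproof x y n :
  (x n.+1 + y n.+1 = x n + y n %[mod (p ^ n)%N])%Z.
Proof. by rewrite -modzDm !padic_compS. Qed.

Fact padic_mul_subproof x y n :
  (x n.+1 * y n.+1 = x n * y n %[mod (p ^ n)%N])%Z.
Proof. by rewrite -modzMm !padic_compS. Qed.

Definition padic_const a : Zp := padic_red (padic_const_subproof a).
Definition padic_opp x := padic_red (padic_opp_subproof x).
Definition padic_add x y := padic_red (padic_add_subproof x y).
Definition padic_mul x y := padic_red (padic_mul_subproof x y).

Fact padic_addA : associative padic_add.
Proof. by move=> x y z; apply: padic_eq => n /=; rewrite modzDml modzDmr addrA. Qed.

Fact padic_addC : commutative padic_add.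
Proof. by move=> x y; apply: padic_eq => n /=; rewrite addrC. Qed.

Fact padic_add0 : left_id (padic_const 0) padic_add.
Proof. by move=> x; apply: padic_eq => n /=; rewrite mod0z add0r padic_comp_mod. Qed.

Fact padic_addN : left_inverse (padic_const 0) padic_opp padic_add.
Proof. by move=> x; apply: padic_eq => n /=; rewrite modzDml addNr. Qed.

HB.instance Definition _ :=
  GRing.isZmodule.Build Zp padic_addA padic_addC padic_add0 padic_addN.

Fact padic_mulA : associative padic_mul.
Proof. by move=> x y z; apply: padic_eq => n /=; rewrite modzMml modzMmr mulrA. Qed.

Fact padic_mulC : commutative padic_mul.
Proof. by move=> x y; apply: padic_eq => n /=; rewrite mulrC. Qed.

Fact padic_mul1 : left_id (padic_const 1) padic_mul.
Proof.
by move=> x; apply: padic_eq => n /=; rewrite modzMml mul1r padic_comp_mod.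
Qed.

Fact padic_mulDl : left_distributive padic_mul +%R.
Proof.
move=> x y z; apply: padic_eq => n /=.
by rewrite modzMml modzDml modzDmr mulrDl.
Qed.

Fact padic_oner_neq0 : padic_const 1 != 0.
Proof.
apply/eqP => /(congr1 (fun x : Zp => x 1%N)) /=.
by rewrite expn1 mod0z modz_small //= ltz_nat prime_gt1.
Qed.

HB.instance Definition _ := GRing.Zmodule_isComNzRing.Build Zp
  padic_mulA padic_mulC padic_mul1 padic_mulDl padic_oner_neq0.

Lemma padic_comp0 n : (0 : Zp) n = 0.
Proof. exact: mod0z. Qed.

Lemma padic_comp1 n : (1 : Zp) n = (1 %% (p ^ n)%N)%Z.
Proof. by []. Qed.

Lemma padic_compN x n : (- x) n = (- x n %% (p ^ n)%N)%Z.
Proof. by []. Qed.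

Lemma padic_compD x y n : (x + y) n = ((x n + y n) %% (p ^ n)%N)%Z.
Proof. by []. Qed.

Lemma padic_compM x y n : (x * y) n = ((x n * y n) %% (p ^ n)%N)%Z.
Proof. by []. Qed.

Definition padic_unit : {pred Zp} := fun x => `[< exists y, y * x = 1 >].

Definition padic_inv x : Zp :=
  if pselect (exists y, y * x = 1) is left ex then projT1 (cid ex) else x.

Fact padic_mulVx : {in padic_unit, left_inverse 1 padic_inv *%R}.
Proof.
move=> x /asboolP ux; rewrite /padic_inv.
by case: pselect => // ex; case: cid.
Qed.

Fact padic_unitP x y : y * x = 1 -> padic_unit x.
Proof. by move=> yx1; apply/asboolP; exists y. Qed.

Fact padic_inv_out : {in [predC padic_unit], padic_inv =1 id}.
Proof.
by move=> x /asboolPn nux; rewrite /padic_inv; case: pselect.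
Qed.

HB.instance Definition _ := GRing.ComNzRing_hasMulInverse.Build Zp
  padic_mulVx padic_unitP padic_inv_out.

Lemma padic_compDm x n m : (x (m + n)%N %% (p ^ n)%N)%Z = x n.
Proof.
elim: m => [|m IHm]; first exact: padic_comp_mod.
rewrite -IHm -[in RHS](padic_compS x (m + n)) addSn modz_dvd_mod ?dvdz_pexp ?leq_addl //.
Qed.

Fact padic_integral x y : x * y = 0 -> (x == 0) || (y == 0).
Proof.
have nz (z : Zp) : z != 0 -> exists n, forall m, ~~ (p ^ n %| `|z (m + n)%N|)%N.
  move=> z0; have [n zn] : exists n, z n != 0.
    apply: contrapT => zn; case/eqP: z0; apply: padic_eq => n.
    rewrite padic_comp0; apply/eqP; apply: contrapT => /negP zn0.
    by apply: zn; exists n.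
  exists n => m; apply: contra zn => dz.
  by rewrite -(padic_compDm z n m); apply/eqP/dvdz_mod0P.
move=> xy0; apply/norP => -[/nz[n xn] /nz[m ym]].
have /(congr1 (fun z : Zp => z (n + m)%N)) := xy0.
rewrite padic_compM padic_comp0 => /dvdz_mod0P; rewrite dvdzE abszM /=.
have := xn m; rewrite addnC => {}xn; have {}ym := ym n.
case: (posnP `|x (n + m)%N|) xn => [-> | x_gt0]; first by rewrite dvdn0.
case: (posnP `|y (n + m)%N|) ym => [-> | y_gt0]; first by rewrite dvdn0.
rewrite !pfactor_dvdn // ?muln_gt0 ?x_gt0 // lognM // -!ltnNge => lty ltx.
by apply/negP; rewrite -ltnNge -addSn leq_add // ltnW.
Qed.

HB.instance Definition _ := GRing.ComUnitRing_isIntegral.Build Zp padic_integral.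

End PadicInt.

Definition padic (p : nat) (p_pr : prime p) : fieldType :=
  {fraction padic_int p_pr}.

Section IntegerRing.
Variables (p : nat) (p_pr : prime p) (K : fieldExtType (padic p_pr)).

Definition padic_int_embed : {rmorphism padic_int p_pr -> K} :=
  in_alg K \o @FracField.tofrac (padic_int p_pr).

Definition integers : {pred K} :=
  fun x => `[< integralOver padic_int_embed x >].

Lemma integers_subring : subring_closed integers.
Proof.
split=> [|x y /asboolP xO /asboolP yO|x y /asboolP xO /asboolP yO];
  apply/asboolP; [exact: integral1 | exact: integral_sub | exact: integral_mul].
Qed.

Record integer_ring := IntegerRing {
  integer_val :> K;
  _ : integer_val \in integers }.

HB.instance Definition _ := [isSub for integer_val].
HB.instance Definition _ := [Choice of integer_ring by <:].
HB.instance Definition _ :=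
  GRing.isSubringClosed.Build K integers integers_subring.
HB.instance Definition _ :=
  GRing.SubChoice_isSubComNzRing.Build K integers integer_ring
    integers_subring.

End IntegerRing.
Arguments integers {p p_pr} K.

Definition preserves_lattice (p : nat) (p_pr : prime p)
    (K : fieldExtType (padic p_pr)) (n : nat) (M : 'M[K]_n) : Prop :=
  forall w : 'cV[K]_n, (forall i, w i 0 \in integers K) ->
    forall i, (M *m w) i 0 \in integers K.

(* [idealr_closed] includes properness.                                       *)
Definition maximal_ideal (O : comNzRingType) (m : {pred O}) : Prop :=
  idealr_closed m /\
  forall J : {pred O}, idealr_closed J -> {subset m <= J} -> {subset J <= m}.

Section ResidueField.
Variables (O : comNzRingType) (m : {pred O}) (m_max : maximal_ideal m).

Definition maximal_ideal_pred of maximal_ideal m : {pred O} := m.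
HB.instance Definition _ :=
  isIdealr.Build O (maximal_ideal_pred m_max) m_max.1.

Definition residue_field := {ideal_quot (maximal_ideal_pred m_max)}.
HB.instance Definition _ := GRing.ComNzRing.on residue_field.

Definition residue : O -> residue_field :=
  \pi_{ideal_quot (maximal_ideal_pred m_max)}%qT.

Fact residue_zmod_morphism : zmod_morphism residue.
Proof. exact: rmorphB. Qed.
Fact residue_monoid_morphism : monoid_morphism residue.
Proof. by split; [exact: rmorph1 | exact: rmorphM]. Qed.
HB.instance Definition _ :=
  GRing.isZmodMorphism.Build O residue_field residue residue_zmod_morphism.
HB.instance Definition _ :=
  GRing.isMonoidMorphism.Build O residue_field residue residue_monoid_morphism.

Lemma residue_surj (x : residue_field) : exists a, residue a = x.
Proof. by exists (generic_quotient.repr x); exact: reprK. Qed.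

Lemma residue_eq0 a : (residue a == 0) = (a \in m).
Proof.
rewrite -(rmorph0 residue) -[RHS]/(a \in maximal_ideal_pred m_max).
by rewrite -[in RHS](subr0 a) Quotient.idealrBE.
Qed.

Fact residue_inv_exists (x : residue_field) : x != 0 -> exists y, y * x = 1.
Proof.
have [m_ideal m_maximal] := m_max; have [m0 m1 mD] := m_ideal.
have [a <-] := residue_surj x; rewrite residue_eq0 => am.
pose J : {pred O} := fun b => `[< exists c, b - c * a \in m >].
have [/asboolP[c]|J1] := boolP (1 \in J).
  rewrite -residue_eq0 rmorphB rmorph1 rmorphM subr_eq0 => /eqP ca1.
  by exists (residue c).
have mJ : {subset m <= J} by move=> b bm; apply/asboolP; exists 0; rewrite mul0r subr0.
case/negP: am; apply: (m_maximal J _ mJ); last first.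
  by apply/asboolP; exists 1; rewrite mul1r subrr.
split=> [|//|b u v /asboolP[c uc] /asboolP[d vd]]; first exact: mJ.
apply/asboolP; exists (b * c + d).
have -> : b * u + v - (b * c + d) * a = b * (u - c * a) + (v - d * a).
  by rewrite mulrDl mulrBr opprD addrACA mulrA.
exact: mD.
Qed.

Definition residue_inv (x : residue_field) : residue_field :=
  if pselect (exists y, y * x = 1) is left ex then projT1 (cid ex) else 0.

Fact residue_mulVx x : x != 0 -> residue_inv x * x = 1.
Proof.
move=> /residue_inv_exists; rewrite /residue_inv.
by case: pselect => // ex; case: cid.
Qed.

Fact residue_inv0 : residue_inv 0 = 0.
Proof.
rewrite /residue_inv; case: pselect => // ex; exfalso; case: ex => y.
by rewrite mulr0 => /eqP; rewrite eq_sym oner_eq0.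
Qed.

HB.instance Definition _ :=
  GRing.ComNzRing_isField.Build residue_field residue_mulVx residue_inv0.
End ResidueField.

(* Reduction modulo [m] of an element of [K]; meaningful on elements of the   *)
(* ring of integers only (the junk value elsewhere is 0).                     *)
Definition reduce (p : nat) (p_pr : prime p) (K : fieldExtType (padic p_pr))
    (m : {pred integer_ring K}) (m_max : maximal_ideal m) (x : K) :
    residue_field m_max :=
  residue m_max (insubd 0 x).

Section Graph.
Variables (T : finType) (e : rel T).

Definition strongly_regular (v k l mu : nat) : Prop :=
  [/\ symmetric e, irreflexive e, #|T| = v &
  [/\ forall x, #|[set y | e x y]| = k,
      forall x y, e x y -> #|[set z | e x z && e y z]| = l
    & forall x y, x != y -> ~~ e x y -> #|[set z | e x z && e y z]| = mu]].

Definition connected_graph : Prop := forall x y, connect e x y.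

Definition complete_graph : Prop := forall x y, x != y -> e x y.

Definition graph_automorphism (s : {perm T}) : Prop :=
  forall x y, e (s x) (s y) = e x y.

(* Vertex-indexed matrices are indexed by ranks in the enumeration of [T].    *)
Definition adjmx (R : nzRingType) : 'M[R]_#|T| :=
  \matrix_(i, j) (e (enum_val i) (enum_val j))%:R.

Definition bose_mesner_mx (R : nzRingType) (a b c : R) : 'M[R]_#|T| :=
  a *: 1%:M + b *: adjmx R + c *: const_mx 1.

Definition principal_submx (R : Type) (F : {set T}) (M : 'M[R]_#|T|) :
    'M[R]_#|F| :=
  mxsub (fun i : 'I_#|F| => enum_rank (enum_val i))
        (fun i : 'I_#|F| => enum_rank (enum_val i)) M.

Definition fixed_vertices (s : {perm T}) : {set T} := [set u | s u == u].

Definition moved_to_neighbour (s : {perm T}) : {set T} := [set u | e u (s u)].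

End Graph.

Section Eigenvalues.
Variables k l mu : nat.

Definition srg_discr : algC := (l%:R - mu%:R) ^+ 2 + 4 * (k%:R - mu%:R).
Definition srg_r : algC := (l%:R - mu%:R + sqrtC srg_discr) / 2.
Definition srg_s : algC := (l%:R - mu%:R - sqrtC srg_discr) / 2.
End Eigenvalues.

Definition srg_idempotent (T : finType) (e : rel T) (v k : nat)
    (theta theta' : algC) : 'M[algC]_#|T| :=
  (theta - theta')^-1 *:
    (adjmx e algC - theta'%:M - const_mx ((k%:R - theta') / v%:R)).

(* Main.v *)
Require Import Defs.
From HB Require Import structures.
From mathcomp Require Import all_boot all_order all_fingroup all_algebra.
From mathcomp Require Import all_solvable all_field.
From mathcomp Require Import boolp zify ring.
Set Implicit Arguments.
Unset Strict Implicit.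
Unset Printing Implicit Defensive.
Import Order.TTheory GRing.Theory Num.Theory.
Local Open Scope ring_scope.

(** The left-hand side is the trace of [E P], where [P] is the permutation
    matrix of [x]: it is the sum over all vertices [u] of [E u (x u)].  The
    matrix [E] is idempotent, commutes with [P], and has entries in [O].
    Abstractly, [E O^V] is a direct summand of a permutation module of a cyclic
    group of order [p], hence a sum of [a] trivial and [b] free modules; [x] has
    trace [a] on it, and [a] is the rank of [E] on the Brauer quotient
    [kappa^F] of the permutation module, where [E] acts by the reduction of
    [E_F].  The proof makes this explicit by matrices.

    Let [R] be a set of representatives of the orbits of length [p].  For a
    [p]-th root of unity [z], a function [f] on the vertices such that
    [f (x u) = z f u] for all [u] is determined by its values on [R] if
    [z <> 1], and by its values on [F] and [R] if [z = 1].  On these values [E]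
    acts by the matrix [twist z], with [(u, w)] entry the sum over [i < p] of
    [z^i * E u (x^i w)], if [z <> 1], and by the block matrix [orbit_mx] if
    [z = 1].  All these matrices are idempotent.  Apart from the diagonal of
    [E_F], which contributes to [orbit_mx] only, their traces are the discrete
    Fourier transform of the sums [t_i] over [u] in [R] of [E u (x^i u)], and
    the trace of [E P] is the trace of [E_F] plus [p t_1].

    The trace of an idempotent matrix over a field of characteristic 0 is its
    rank, and ranks of idempotents do not change under specialization
    ([char_poly_idempotent_transfer]): the characteristic polynomial of an
    idempotent of rank [r] is [(X - 1)^r X^m], whose coefficients are integers.
    In characteristic [p] a [p]-th root of unity becomes [1].  So every
    [twist z] with [z <> 1] has the rank [b] of [twist 1] over [kappa], and
    [orbit_mx] becomes block triangular with diagonal blocks [E_F] and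
    [twist 1], so that its rank is [a + b] with [a] the rank of [E_F].
    Fourier inversion ([fourier_coef1]) then turns the traces [a + b] (for
    [z = 1]) and [b] (for the other [z]) into the trace [a] of [E P]
    ([twisted_trace_eq_rank]).

    The specialization sending [z] to [1] exists by integrality
    ([residue_specialize]): since [(z - 1)^p] is [p] times an integral element,
    an element of [O] divisible by [z - 1] has its [p]-th power divisible by
    [p] in [O], and [p] lies in the maximal ideal ([residue_char]). *)

(** * Ranks of idempotent matrices *)

Section Idempotent.
Variables (F : fieldType) (n : nat) (M : 'M[F]_n).
Hypothesis M_idem : M *m M = M.

(** From a decomposition [M = C D U] with [C], [U] invertible and [D] the partial
    identity, [P] takes its first rows (a basis of the row space of [M]) from
    [U], and the others (which [M] kills on the right) from the inverse of
    [C]. *)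
Lemma idempotent_pid_mx :
  exists2 P, P \in unitmx & P *m M = pid_mx (\rank M) *m P.
Proof.
set r := \rank M; have r_le : (r <= n)%N := rank_leq_row M.
have Lu := col_ebase_unit M; have Uu := row_ebase_unit M.
pose D : 'M[F]_n := pid_mx r; pose D' : 'M[F]_n := copid_mx r.
have DD : D *m D = D by rewrite pid_mx_id.
have DD' : D *m D' = 0 by rewrite mul_pid_mx_copid.
have D'D : D' *m D = 0 by rewrite mul_copid_mx_pid.
have DM : M = col_ebase M *m D *m row_ebase M by rewrite mulmx_ebase.
have LM : invmx (col_ebase M) *m M = D *m row_ebase M.
  by rewrite [X in _ *m X]DM -mulmxA (mulKmx Lu).
pose P := D *m row_ebase M + D' *m invmx (col_ebase M).
have DP : D *m P = D *m row_ebase M.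
  by rewrite mulmxDr !mulmxA DD DD' mul0mx addr0.
have PM : P *m M = D *m P.
  rewrite DP mulmxDl -LM -!mulmxA M_idem LM.
  by rewrite (mulmxA D') D'D mul0mx addr0.
exists P => //; rewrite -row_free_unit -kermx_eq0; apply/eqP/row_matrixP => i.
rewrite row0; set v := row i _.
have vP : v *m P = 0 by apply/sub_kermxP; apply: row_sub.
have v0 : v *m D = 0.
  apply: (can_inj (mulmxK Uu)).
  by rewrite mul0mx -mulmxA -DP -PM mulmxA vP mul0mx.
have vc : v *m D' = v by rewrite mulmxBr mulmx1 v0 subr0.
apply: (can_inj (mulmxKV Lu)); rewrite mul0mx -[in LHS]vc -[RHS]vP.
by rewrite [v *m P]mulmxDr !mulmxA v0 mul0mx add0r.
Qed.

Lemma char_poly_idempotent :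
  exists m, char_poly M = ('X - 1) ^+ \rank M * 'X ^+ m.
Proof.
have [P Pu PM] := idempotent_pid_mx; have r_le := rank_leq_row M.
have -> : char_poly M = char_poly (pid_mx (\rank M) : 'M[F]_n).
  have dP : \det (map_mx (@polyC F) P) != 0.
    by rewrite det_map_mx polyC_eq0 -unitfE -unitmxE.
  apply: (mulfI dP); rewrite -det_mulmx [RHS]mulrC -det_mulmx /char_poly_mx.
  by rewrite mulmxBr mulmxBl -!map_mxM PM mul_scalar_mx mul_mx_scalar.
rewrite char_poly_trig; last first.
  by apply/is_trig_mxP => i j ij; rewrite mxE (ltn_eqF ij).
rewrite (bigID (fun i : 'I_n => i < \rank M)%N) /=.
rewrite (eq_bigr (fun=> 'X - 1)) => [|i ir]; last by rewrite mxE eqxx ir.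
rewrite -(big_ord_widen _ (fun=> 'X - 1)) // prodr_const card_ord.
rewrite [X in _ * X](eq_bigr (fun=> 'X)) => [|i /negPf ir]; last first.
  by rewrite mxE eqxx ir subr0.
by rewrite prodr_const; eexists.
Qed.

Lemma trace_idempotent : \tr M = (\rank M)%:R.
Proof.
have [P Pu PM] := idempotent_pid_mx.
have DM : M = invmx P *m (pid_mx (\rank M) *m P) by rewrite -PM mulKmx.
rewrite [X in \tr X]DM mxtrace_mulC mulmxK // /mxtrace.
rewrite (eq_bigr (fun i : 'I_n => if (i < \rank M)%N then 1 else 0)) => [|i _].
  rewrite -big_mkcond /= -(big_ord_widen _ (fun=> 1)) ?rank_leq_row //.
  by rewrite sumr_const card_ord.
by rewrite mxE eqxx /=; case: ifP.
Qed.

(** Reading the rank off the characteristic polynomial makes it additive on block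
    triangular matrices. *)
Lemma mup_char_poly_idempotent : mup 1 (char_poly M) = \rank M.
Proof.
have [m ->] := char_poly_idempotent.
by rewrite mupMl ?rootE ?hornerXn ?expr1n ?oner_eq0 // mup_XsubCX eqxx.
Qed.

End Idempotent.

Section Transfer.
Variables (S : comNzRingType) (F1 F2 : fieldType).
Variables (f : {rmorphism S -> F1}) (g : {rmorphism S -> F2}).
Hypothesis ker_fg : forall s, f s = 0 -> g s = 0.

(** The coefficients of [(X - 1)^r X^m] are images of integers, so an equality of
    the characteristic polynomial with it under [f] persists under [g]. *)
Lemma char_poly_idempotent_transfer n (M : 'M[S]_n) :
    map_mx f M *m map_mx f M = map_mx f M ->
  mup 1 (char_poly (map_mx g M)) = \rank (map_mx f M).
Proof.
move=> /char_poly_idempotent; move: (\rank _) => r [m].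
rewrite -map_char_poly => Ef.
rewrite -map_char_poly.
have -> : map_poly g (char_poly M) = ('X - 1) ^+ r * 'X ^+ m.
  have Dq (F : fieldType) (h : {rmorphism S -> F}) :
      map_poly h (('X - 1) ^+ r * 'X ^+ m) = ('X - 1) ^+ r * 'X ^+ m.
    by rewrite rmorphM rmorphXn rmorphB /= rmorph1 map_polyX map_polyXn.
  rewrite -(Dq _ f) in Ef; rewrite -(Dq _ g).
  apply/polyP => i; rewrite !coef_map; apply/eqP; rewrite -subr_eq0 -rmorphB.
  apply/eqP/ker_fg; rewrite rmorphB; move/polyP/(_ i): Ef.
  by rewrite !coef_map /= => ->; rewrite subrr.
by rewrite mupMl ?rootE ?hornerXn ?expr1n ?oner_eq0 // mup_XsubCX eqxx.
Qed.
End Transfer.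

(** * Orbits of a permutation of prime order *)

Section FreeOrbits.
Variables (T : finType) (x : {perm T}) (p : nat).
Hypotheses (p_pr : prime p) (x_order : #[x]%g = p).

Definition free_orbit_reps : {set T} :=
  [set u | froot x u == u & u \notin fixed_vertices x].

Lemma fixed_vertexX u i : u \in fixed_vertices x -> (x ^+ i)%g u = u.
Proof.
rewrite inE => /eqP xu; elim: i => [|i IHi]; first by rewrite expg0 perm1.
by rewrite expgSr permM IHi.
Qed.

Lemma free_orbit_inj u : u \notin fixed_vertices x ->
  injective (fun i : 'I_p => (x ^+ i)%g u).
Proof.
move=> xu i j /= Eij; apply: val_inj => /=.
wlog ij : i j Eij / (i < j)%N.
  by move=> IH; case: (ltngtP i j) => // lt; [apply: IH | apply/esym/IH].
case/negP: xu; rewrite inE.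
have d_gt0 : (0 < j - i)%N by rewrite subn_gt0.
have d_ltp : (j - i < p)%N by rewrite (leq_ltn_trans (leq_subr _ _)).
have xd : (x ^+ (j - i))%g u = u.
  by apply: (@perm_inj _ (x ^+ i)%g); rewrite -permM -expgD subnK // ltnW.
have co : coprime #|<[x]>%g| (j - i).
  by rewrite -orderE x_order prime_coprime // gtnNdvd.
have xdX n : (x ^+ (j - i) ^+ n)%g u = u.
  by elim: n => [|n IHn]; rewrite ?expg0 ?perm1 // expgSr permM IHn xd.
by have := xdX (expg_invn <[x]>%g (j - i)); rewrite expgK ?cycle_id // => ->.
Qed.

Lemma free_orbit_imset u : u \in free_orbit_reps ->
  (fun i : 'I_p => (x ^+ i)%g u) @: 'I_p
    = [set w | w \notin fixed_vertices x & froot x w == u].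
Proof.
rewrite inE => /andP[/eqP ru xu].
have csym := fconnect_sym (@perm_inj _ x).
apply/setP => w; rewrite !inE; apply/imsetP/andP => [[i _ ->]|[_ /eqP rw]].
  split; last first.
    by rewrite -[X in _ == X]ru (root_connect csym) csym permX fconnect_iter.
  apply: contra xu; rewrite inE -!permM -expgSr expgS permM.
  by move/eqP/perm_inj/eqP.
have : fconnect x u w by rewrite -(root_connect csym) rw ru.
move=> /iter_findex <-; rewrite -permX -expg_mod_order x_order.
by exists (Ordinal (ltn_pmod (findex x u w) (prime_gt0 p_pr))).
Qed.

Lemma big_free_orbits (V : nmodType) (f : T -> V) :
  \sum_(w in ~: fixed_vertices x) f w
    = \sum_(u in free_orbit_reps) \sum_(i < p) f ((x ^+ i)%g u).
Proof.
have csym := fconnect_sym (@perm_inj _ x).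
rewrite (partition_big (froot x) [in free_orbit_reps]) /= => [|w].
  apply: eq_bigr => u uR.
  rewrite -[RHS](big_imset f (h := fun i : 'I_p => (x ^+ i)%g u) (A := 'I_p)) /=.
    by rewrite free_orbit_imset //; apply: eq_bigl => w; rewrite !inE.
  move=> i j _ _; apply: free_orbit_inj.
  by move: uR; rewrite inE => /andP[].
rewrite !inE (root_root csym) eqxx /= => xw.
have /iter_findex <- : fconnect x w (froot x w) by rewrite connect_root.
apply: contra xw; rewrite -permX -permM -expgSr expgS permM.
by move/eqP/perm_inj/eqP.
Qed.

Lemma big_orbits (V : nmodType) (f : T -> V) :
  \sum_w f w = \sum_(u in fixed_vertices x) f u
    + \sum_(u in free_orbit_reps) \sum_(i < p) f ((x ^+ i)%g u).
Proof.
rewrite (bigID [in fixed_vertices x]) -big_free_orbits /=; congr (_ + _).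
by apply: eq_bigl => w; rewrite in_setC.
Qed.
End FreeOrbits.

(** * Matrices indexed by sets of vertices *)

Section SetMatrix.
Variables (T : finType) (S : nzRingType).
Implicit Types (D : {set T}) (h : T -> T -> S).

Definition set_mx D1 D2 h : 'M[S]_(#|D1|, #|D2|) :=
  \matrix_(i, j) h (enum_val i) (enum_val j).

Lemma mul_set_mx D1 D2 D3 h1 h2 :
  set_mx D1 D2 h1 *m set_mx D2 D3 h2
    = set_mx D1 D3 (fun u w => \sum_(c in D2) h1 u c * h2 c w).
Proof.
apply/matrixP => i j; rewrite !mxE [RHS]big_enum_val /=.
by apply: eq_bigr => c _; rewrite !mxE.
Qed.

Lemma add_set_mx D1 D2 h1 h2 :
  set_mx D1 D2 h1 + set_mx D1 D2 h2 = set_mx D1 D2 (fun u w => h1 u w + h2 u w).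
Proof. by apply/matrixP => i j; rewrite !mxE. Qed.

Lemma eq_set_mx D1 D2 h1 h2 : {in D1 & D2, h1 =2 h2} ->
  set_mx D1 D2 h1 = set_mx D1 D2 h2.
Proof. by move=> Eh; apply/matrixP => i j; rewrite !mxE Eh ?enum_valP. Qed.

Lemma tr_set_mx D h : \tr (set_mx D D h) = \sum_(u in D) h u u.
Proof.
by rewrite [RHS]big_enum_val; apply: eq_bigr => i _; rewrite mxE.
Qed.
End SetMatrix.

Lemma map_set_mx (T : finType) (S S' : nzRingType) (f : S -> S')
    (D1 D2 : {set T}) (h : T -> T -> S) :
  map_mx f (set_mx D1 D2 h) = set_mx D1 D2 (fun u w => f (h u w)).
Proof. by apply/matrixP => i j; rewrite !mxE. Qed.

(** * Action of an invariant idempotent on the eigenspaces of a permutation *)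

Section Twist.
Variables (T : finType) (x : {perm T}) (p : nat).
Hypotheses (p_pr : prime p) (x_order : #[x]%g = p).
Variables (S : comNzRingType) (E : T -> T -> S).
Hypothesis E_inv : forall u w, E (x u) (x w) = E u w.
Hypothesis E_idem : forall u w, \sum_c E u c * E c w = E u w.

Local Notation F := (fixed_vertices x).
Local Notation R := (free_orbit_reps x).

(** On functions [f] on [T] that vanish on [F] and satisfy
    [f (x^i w) = z^i f w], the matrix [E] acts through their values on [R] by
    this matrix. *)
Definition twist (z : S) (u w : T) : S :=
  \sum_(i < p) z ^+ i * E u ((x ^+ i)%g w).

Lemma invariantX i u w : E ((x ^+ i)%g u) ((x ^+ i)%g w) = E u w.
Proof. by elim: i => [|i IHi]; rewrite ?expg0 ?perm1 // expgSr !permM E_inv. Qed.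

Lemma twistX z i u w : z ^+ p = 1 ->
  twist z ((x ^+ i)%g u) w = z ^+ i * twist z u w.
Proof.
move=> zp; elim: i => [|i IHi]; first by rewrite expg0 perm1 expr0 mul1r.
rewrite expgSr permM exprS -mulrA -IHi; move: ((x ^+ i)%g u) => {IHi}u.
rewrite /twist mulr_sumr; pose G j := z ^+ j * E (x u) ((x ^+ j)%g w).
rewrite -[LHS](big_mkord xpredT G) -(prednK (prime_gt0 p_pr)).
rewrite big_nat_recl // addrC.
(* The terms are [p]-periodic in the exponent, so the sum can be shifted. *)
have -> : G 0%N = G p.-1.+1.
  by rewrite prednK ?prime_gt0 // /G -x_order expg_order x_order zp.
rewrite -[LHS](big_nat_recr _ _ (fun j => G j.+1)) //= big_mkord.
by apply: eq_bigr => j _; rewrite /G exprS mulrA expgSr permM E_inv.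
Qed.

Lemma twist_fixed z u w : u \in F -> twist z u w = (\sum_(i < p) z ^+ i) * E u w.
Proof.
move=> uF; rewrite mulr_suml; apply: eq_bigr => i _.
by rewrite -[in E u (_ w)](fixed_vertexX i uF) invariantX.
Qed.

Lemma twist_orbit_sum z u (h : T -> S) :
    (forall i c, h ((x ^+ i)%g c) = z ^+ i * h c) ->
  \sum_(c in R) twist z u c * h c = \sum_(c in ~: F) E u c * h c.
Proof.
move=> hX; rewrite (big_free_orbits p_pr x_order); apply: eq_bigr => c _.
rewrite mulr_suml; apply: eq_bigr => i _.
by rewrite hX mulrCA mulrA.
Qed.

(** [twist z] is the product of the idempotent [E] with a matrix whose columns
    are [z]-eigenvectors, so [E] fixes it; splitting the sum over all vertices
    into fixed points and free orbits gives this form. *)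
Lemma mul_twist z u w : z ^+ p = 1 ->
  \sum_(c in F) E u c * twist z c w + \sum_(c in R) twist z u c * twist z c w
    = twist z u w.
Proof.
move=> zp; rewrite twist_orbit_sum => [|i c]; last exact: twistX.
transitivity (\sum_c E u c * twist z c w).
  rewrite [RHS](bigID [in F]) /=; congr (_ + _).
  by apply: eq_bigl => c; rewrite in_setC.
under eq_bigr do rewrite mulr_sumr.
rewrite exchange_big; apply: eq_bigr => i _ /=.
by rewrite -[in RHS]E_idem mulr_sumr; apply: eq_bigr => c _; rewrite mulrCA.
Qed.

(** The fixed points contribute nothing, because on them [twist z] has the factor
    [\sum_(i < p) z ^+ i].  The hypothesis covers both a nontrivial root of unity
    in a field and [z = 1] in characteristic [p]. *)
Lemma twist_idempotent z : \sum_(i < p) z ^+ i = 0 ->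
  set_mx R R (twist z) *m set_mx R R (twist z) = set_mx R R (twist z).
Proof.
move=> z0; have zp : z ^+ p = 1.
  by apply/eqP; rewrite -subr_eq0 subrX1 z0 mulr0.
rewrite mul_set_mx; apply: eq_set_mx => u w _ _.
rewrite -[RHS](mul_twist _ _ zp) [X in _ = X + _]big1 ?add0r // => c cF.
by rewrite twist_fixed // z0 mul0r mulr0.
Qed.

(** The action of [E] on the [x]-invariant functions, in the basis of indicator
    functions of the orbits. *)
Definition orbit_mx : 'M[S]_(#|F| + #|R|) :=
  block_mx (set_mx F F E) (set_mx F R (twist 1))
           (set_mx R F E) (set_mx R R (twist 1)).

Lemma orbit_mx_idempotent : orbit_mx *m orbit_mx = orbit_mx.
Proof.
have EF u w : w \in F ->
    \sum_(c in F) E u c * E c w + \sum_(c in R) twist 1 u c * E c w = E u w.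
  move=> wF; rewrite twist_orbit_sum => [|i c]; last first.
    by rewrite expr1n mul1r -[in LHS](fixed_vertexX i wF) invariantX.
  rewrite -[RHS]E_idem [RHS](bigID [in F]) /=; congr (_ + _).
  by apply: eq_bigl => c; rewrite in_setC.
rewrite mulmx_block !mul_set_mx !add_set_mx; congr block_mx;
  apply: eq_set_mx => u w *; by [apply: EF | apply/mul_twist/expr1n].
Qed.

(** Moving [x^i] to the first argument of [E], where it fixes the vertex, shows
    that each entry is a sum of [p] equal terms. *)
Lemma twist1_fixed_eq0 : p%:R = 0 :> S -> set_mx F R (twist 1) = 0.
Proof.
move=> p0; apply/matrixP => i j; rewrite !mxE twist_fixed ?enum_valP //.
by under eq_bigr do rewrite expr1n; rewrite sumr_const card_ord p0 mul0r.
Qed.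

Lemma char_poly_orbit_mx : p%:R = 0 :> S ->
  char_poly orbit_mx
    = char_poly (set_mx F F E) * char_poly (set_mx R R (twist 1)).
Proof.
move=> p0; rewrite /orbit_mx twist1_fixed_eq0 // /char_poly /char_poly_mx.
rewrite map_block_mx map_mx0 scalar_mx_block opp_block_mx add_block_mx.
by rewrite oppr0 addr0 det_lblock.
Qed.

Lemma fixed_idempotent : p%:R = 0 :> S ->
  set_mx F F E *m set_mx F F E = set_mx F F E.
Proof.
move=> p0; move: orbit_mx_idempotent; rewrite mulmx_block.
by case/eq_block_mx => + _ _ _; rewrite twist1_fixed_eq0 // mul0mx addr0.
Qed.

End Twist.

(** * The trace of an invariant idempotent *)

Lemma sum_unity_root (R : idomainType) n (z : R) :
  z ^+ n = 1 -> z != 1 -> \sum_(i < n) z ^+ i = 0.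
Proof.
move=> zn z1; apply/eqP; have /eqP := subrX1 z n.
by rewrite zn subrr eq_sym mulf_eq0 subr_eq0 (negPf z1).
Qed.

(** Fourier inversion at index 1, for a transform equal to [s + b] at the trivial
    character and to [b] at all others: the constant [b] is the transform of a
    function supported at index 0, hence does not contribute. *)
Lemma fourier_coef1 (R : idomainType) n (z : R) (t : nat -> R) (s b : R) :
    (1 < n)%N -> n.-primitive_root z ->
    \sum_(i < n) t i = s + b ->
    (forall j, (0 < j < n)%N -> \sum_(i < n) (z ^+ j) ^+ i * t i = b) ->
  n%:R * t 1%N = s.
Proof.
case: n => [|[|n]] // _ z_prim t0 tj; have zn := prim_expr_order z_prim.
have zX k : (z ^+ k) ^+ n.+2 = 1 by rewrite exprAC zn expr1n.
(* [z^(n+1)] is the inverse of [z]. *)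
transitivity (\sum_(j < n.+2)
    (z ^+ j) ^+ n.+1 * \sum_(i < n.+2) (z ^+ j) ^+ i * t i).
  under [RHS]eq_bigr do rewrite mulr_sumr.
  rewrite exchange_big (bigD1 1) //= [X in _ + X]big1 => [|i i1].
    rewrite addr0 -[X in X%:R * _]card_ord -sumr_const mulr_suml.
    by apply: eq_bigr => j _; rewrite mulrA -exprD addn1 zX.
  transitivity ((\sum_(j < n.+2) (z ^+ (n.+1 + i)) ^+ j) * t i).
    rewrite mulr_suml; apply: eq_bigr => j _.
    by rewrite mulrA -exprD -!exprM mulnC.
  rewrite sum_unity_root ?zX ?mul0r // -(prim_order_dvd z_prim).
  apply: contra i1 => /dvdnP[q Eq]; apply/eqP/val_inj => /=.
  rewrite modn_small //; have := ltn_ord i; case: q Eq => [|[|q]] Eq; lia.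
rewrite big_ord_recl expr0 expr1n mul1r.
under eq_bigr do rewrite expr1n mul1r.
rewrite t0 (eq_bigr (fun j : 'I_n.+1 => (z ^+ n.+1) ^+ j.+1 * b)) => [|j _].
  rewrite -mulr_suml.
  have := @sum_unity_root _ n.+2 (z ^+ n.+1) (zX _).
  rewrite big_ord_recl expr0 -(prim_order_dvd z_prim) gtnNdvd // => /(_ isT).
  move/eqP; rewrite addrC addr_eq0 => /eqP ->.
  by rewrite mulN1r addrK.
rewrite tj; last by rewrite lift0 !ltnS leq0n leq_ord.
by rewrite exprAC.
Qed.

Section TwistedTrace.
Variables (T : finType) (x : {perm T}) (p : nat).
Hypotheses (p_pr : prime p) (x_order : #[x]%g = p).
Variables (O : comNzRingType) (K k : fieldType).
Variables (f : {rmorphism O -> K}) (g : {rmorphism O -> k}).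
(* [f q(z)] determines [g q(1)]: there is a specialization of the ring generated
   by [z] over the image of [O] that sends [z] to [1] and extends [g]. *)
Hypothesis specialize : forall (z : K) (q : {poly O}),
  z ^+ p = 1 -> (map_poly f q).[z] = 0 -> (map_poly g q).[1] = 0.
Variable E : T -> T -> O.
Hypothesis E_inv : forall u w, E (x u) (x w) = E u w.
Hypothesis E_idem : forall u w, \sum_c E u c * E c w = E u w.
Variable z : K.
Hypothesis z_prim : p.-primitive_root z.
Hypothesis (pk : p%:R = 0 :> k).

Local Notation F := (fixed_vertices x).
Local Notation R := (free_orbit_reps x).
Local Notation fE := (fun u w => f (E u w)).
Local Notation gE := (fun u w => g (E u w)).

Let inv (S : comNzRingType) (h : {rmorphism O -> S}) u w :
  h (E (x u) (x w)) = h (E u w).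
Proof. by rewrite E_inv. Qed.

Let idem (S : comNzRingType) (h : {rmorphism O -> S}) u w :
  \sum_c h (E u c) * h (E c w) = h (E u w).
Proof.
by rewrite -[in RHS]E_idem rmorph_sum; apply: eq_bigr => c _; rewrite rmorphM.
Qed.

Let ker s : f s = 0 -> g s = 0.
Proof.
move=> fs; have := @specialize 1 s%:P.
by rewrite expr1n !map_polyC /= !hornerC; apply.
Qed.

Let a := \rank (set_mx F F gE).
Let b := \rank (set_mx R R (twist x p gE 1)).

Let gB_idem : set_mx R R (twist x p gE 1) *m set_mx R R (twist x p gE 1)
  = set_mx R R (twist x p gE 1).
Proof.
apply: (twist_idempotent p_pr x_order (inv g) (idem g)).
by under eq_bigr do rewrite expr1n; rewrite sumr_const card_ord.
Qed.

Let map_twist (S : comNzRingType) (h : {rmorphism O -> S}) u w :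
  h (twist x p E 1 u w) = twist x p (fun u w => h (E u w)) 1 u w.
Proof.
by rewrite rmorph_sum; apply: eq_bigr => i _; rewrite rmorphM rmorphXn rmorph1.
Qed.

Let map_orbit_mx (S : comNzRingType) (h : {rmorphism O -> S}) :
  map_mx h (orbit_mx x p E) = orbit_mx x p (fun u w => h (E u w)).
Proof.
rewrite map_block_mx !map_set_mx; congr block_mx;
  by apply: eq_set_mx => u w _ _; rewrite map_twist.
Qed.

(** The rank of the specialization, which is block triangular. *)
Lemma trace_orbit_mx : \tr (orbit_mx x p fE) = a%:R + b%:R.
Proof.
have fM := orbit_mx_idempotent p_pr x_order (inv f) (idem f).
rewrite trace_idempotent // -natrD; congr _%:R.
rewrite -map_orbit_mx -(char_poly_idempotent_transfer ker) map_orbit_mx //.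
rewrite (char_poly_orbit_mx (inv g)) // mupM ?monic_neq0 ?char_poly_monic //.
rewrite !mup_char_poly_idempotent //.
exact: (fixed_idempotent p_pr x_order (inv g) (idem g)).
Qed.

(** The matrix is transferred from the polynomial ring over [O], where the root of
    unity is replaced with the variable: evaluation at [z^j] gives the matrix
    over [K], and at [1] the one over [k]. *)
Lemma trace_twist j : (0 < j < p)%N ->
  \sum_(u in R) twist x p fE (z ^+ j) u u = b%:R.
Proof.
case/andP=> j_gt0 j_lt; pose y := z ^+ j.
have yp : y ^+ p = 1 by rewrite exprAC (prim_expr_order z_prim) expr1n.
have y1 : y != 1 by rewrite -(prim_order_dvd z_prim) gtnNdvd.
have fB := twist_idempotent p_pr x_order (inv f) (idem f) (sum_unity_root yp y1).
rewrite -tr_set_mx trace_idempotent //; congr _%:R.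
pose B : 'M[{poly O}]_#|R| := set_mx R R (twist x p (fun u w => (E u w)%:P) 'X).
pose ev (L : fieldType) (h : {rmorphism O -> L}) c :
  {rmorphism {poly O} -> L} := horner_eval c \o map_poly h.
have evB (L : fieldType) (h : {rmorphism O -> L}) (c : L) :
    map_mx (ev L h c) B = set_mx R R (twist x p (fun u w => h (E u w)) c).
  rewrite map_set_mx; apply: eq_set_mx => u w _ _.
  rewrite rmorph_sum; apply: eq_bigr => i _; rewrite rmorphM rmorphXn /=.
  by rewrite map_polyX map_polyC /horner_eval hornerX hornerC.
have ker_ev q : ev K f y q = 0 -> ev k g 1 q = 0 by apply: specialize.
rewrite -evB -(char_poly_idempotent_transfer ker_ev) !evB //.
by rewrite mup_char_poly_idempotent.
Qed.

Theorem twisted_trace_eq_rank :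
  f (\sum_u E u (x u)) = (\rank (set_mx F F gE))%:R.
Proof.
rewrite rmorph_sum /= (big_orbits p_pr x_order (fun u => f (E u (x u)))).
pose t i := \sum_(u in R) f (E u ((x ^+ i)%g u)).
have Dt c : \sum_(u in R) twist x p fE c u u = \sum_(i < p) c ^+ i * t i.
  rewrite exchange_big; apply: eq_bigr => i _; by rewrite mulr_sumr.
have t0 : \sum_(i < p) t i = (a%:R - \sum_(u in F) f (E u u)) + b%:R.
  have := trace_orbit_mx; rewrite mxtrace_block !tr_set_mx Dt.
  under [X in _ + X = _]eq_bigr do rewrite expr1n mul1r.
  by move=> /(canRL (addKr _)) ->; rewrite addrCA addrA [_ - _]addrC.
have tj j (j_in : (0 < j < p)%N) : \sum_(i < p) (z ^+ j) ^+ i * t i = b%:R.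
  by rewrite -Dt trace_twist.
have -> : \sum_(u in F) f (E u (x u)) = \sum_(u in F) f (E u u).
  by apply: eq_bigr => u; rewrite inE => /eqP ->.
have -> : \sum_(u in R) \sum_(i < p) f (E ((x ^+ i)%g u) (x ((x ^+ i)%g u)))
    = p%:R * \sum_(u in R) f (E u (x u)).
  rewrite mulr_sumr; apply: eq_bigr => u _.
  rewrite -[X in X%:R * _]card_ord -sumr_const mulr_suml; apply: eq_bigr => i _.
  rewrite -permM -expgSr expgS permM mul1r; congr (f _).
  exact: (invariantX E_inv).
suff -> : p%:R * \sum_(u in R) f (E u (x u)) = a%:R - \sum_(u in F) f (E u u).
  by rewrite addrC subrK.
exact: (fourier_coef1 (prime_gt1 p_pr) z_prim t0 tj).
Qed.
End TwistedTrace.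

(** * Integers of a finite extension of the field of p-adic numbers *)

Lemma padic_comp_nat p (p_pr : prime p) (m n : nat) :
  (m%:R : padic_int p_pr) n = (m %% (p ^ n)%N)%Z.
Proof.
elim: m => [|m IHm]; first by rewrite padic_comp0 mod0z.
by rewrite mulrS padic_compD IHm padic_comp1 modzDm -addn1 PoszD addrC.
Qed.

(** Inverses modulo the powers of [p] exist by coprimality and are coherent by
    uniqueness. *)
Lemma padic_int_unit p (p_pr : prime p) (x : padic_int p_pr) :
  x 1%N != 0 -> exists y, x * y = 1.
Proof.
move=> x1; have cop n : coprimez (x n) (p ^ n)%N.
  case: n => [|n]; first by rewrite expn0 coprimezE coprimen1.
  rewrite coprimezE /= coprimeXr // coprime_sym prime_coprime //.
  apply: contra x1 => px; rewrite -(padic_compDm x 1 n) addn1.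
  by apply/eqP/dvdz_mod0P; rewrite expn1 dvdzE.
have inv n : {a : int | ((p ^ n)%N %| x n * a - 1)%Z}.
  have [[u w] /= Euw] := sig_eqW (elimT (coprimezP _ _) (cop n)).
  by exists u; rewrite mulrC -Euw opprD addNKr rpredN dvdz_mull.
pose a n := sval (inv n).
have aP n : ((p ^ n)%N %| x n * a n - 1)%Z by exact: (svalP (inv n)).
have xS n : ((p ^ n)%N %| x n.+1 - x n)%Z.
  by rewrite -eqz_mod_dvd padic_compS padic_comp_mod.
have a_coh n : (a n.+1 = a n %[mod (p ^ n)%N])%Z.
  apply/eqP; rewrite eqz_mod_dvd -(@Gauss_dvdzr _ (x n)); last first.
    by rewrite coprimez_sym.
  have -> : x n * (a n.+1 - a n) = (x n.+1 * a n.+1 - 1)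
      - (x n * a n - 1) - (x n.+1 - x n) * a n.+1 by ring.
  apply: rpredB; last exact: dvdz_mulr.
  by apply: rpredB => //; apply: dvdz_trans (aP n.+1); apply: dvdz_pexp.
exists (padic_red p_pr a_coh); apply: padic_eq => n.
rewrite padic_compM /= modzMmr; apply/eqP.
by rewrite eqz_mod_dvd.
Qed.

(** Adjoin a root of an irreducible factor of [1 + X + ... + X^(p-1)]; such a root
    is not [1], where that polynomial takes the value [p]. *)
Lemma exists_primitive_root_ext (K : fieldType) p :
    prime p -> p%:R != 0 :> K ->
  exists (L : fieldExtType K) (z : L), p.-primitive_root z.
Proof.
move=> p_pr pK; pose q : {poly K} := \poly_(i < p) 1.
have szq : size q = p by rewrite size_poly_eq ?oner_eq0.
have [|n /asboolP[q0 q0q [<- q0_gt1]] n_min] :=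
    @ex_minnP (fun n => `[< exists2 q0, q0 %| q & size q0 = n /\ (1 < n)%N >]).
  by exists p; apply/asboolP; exists q; rewrite ?szq ?prime_gt1.
have q0_irr : irreducible_poly q0.
  split=> // q1 q1_n1 q1q0; rewrite -dvdp_size_eqp // eqn_leq.
  have q0_n0 : q0 != 0 by rewrite -size_poly_gt0 ltnW.
  rewrite dvdp_leq //=; apply: n_min; apply/asboolP; exists q1.
    exact: dvdp_trans q0q.
  split=> //; rewrite ltn_neqAle eq_sym q1_n1 size_poly_gt0.
  by apply: contraNneq q0_n0 => q10; rewrite q10 dvd0p in q1q0.
have [L _ [z q0z _]] := irredp_FAdjoin q0_irr.
exists L, z.
have : root (map_poly (in_alg L) q) z.
  by apply: root_dvdp q0z; rewrite dvdp_map.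
rewrite rootE /q poly_def rmorph_sum horner_sum.
rewrite (eq_bigr (fun i : 'I_p => z ^+ i)) => [|i _]; last first.
  by rewrite scale1r /= map_polyXn hornerXn.
move=> /eqP z0; have zp : z ^+ p = 1.
  by apply/eqP; rewrite -subr_eq0 subrX1 z0 mulr0.
have [[|[|d]] d_prim d_dvd] := prim_order_exists (prime_gt0 p_pr) zp.
- by case/andP: d_prim.
- have z1 : z = 1 by rewrite -(prim_expr_order d_prim) expr1.
  case/eqP: pK; apply: (fmorph_inj (in_alg L)); rewrite rmorph0 rmorph_nat -z0 z1.
  by under eq_bigr do rewrite expr1n; rewrite sumr_const card_ord.
- by move: d_prim; rewrite (prime_nt_dvdP p_pr _ d_dvd).
Qed.

Section ResidueChar.
Variables (p : nat) (p_pr : prime p) (K : fieldExtType (padic p_pr)).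
Variables (m : {pred integer_ring K}) (m_max : maximal_ideal m).

Local Notation O := (integer_ring K).
Local Notation emb := (padic_int_embed K).

Lemma padic_int_embed_integral a : emb a \in integers K.
Proof. by apply/asboolP; exact: integral_id. Qed.

Definition padic_to_integers a : O := IntegerRing (padic_int_embed_integral a).

Fact padic_to_integers_zmod_morphism : zmod_morphism padic_to_integers.
Proof. by move=> a b; apply: val_inj; exact: (rmorphB emb). Qed.

Fact padic_to_integers_monoid_morphism : monoid_morphism padic_to_integers.
Proof.
by split=> [|a b]; apply: val_inj; [exact: (rmorph1 emb) | exact: (rmorphM emb)].
Qed.

HB.instance Definition _ := GRing.isZmodMorphism.Build (padic_int p_pr) O
  padic_to_integers padic_to_integers_zmod_morphism.
HB.instance Definition _ := GRing.isMonoidMorphism.Build (padic_int p_pr) O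
  padic_to_integers padic_to_integers_monoid_morphism.

(** Otherwise some [c] in [O] reduces to the inverse of [p].  Multiplying a monic
    equation of degree [d] for [c] over the p-adic integers by [p^d] and
    reducing shows that a p-adic integer of the form [1 + p a] reduces to [0],
    although it is a unit. *)
Lemma residue_char : p%:R = 0 :> residue_field m_max.
Proof.
apply/eqP; apply: contraT => p_n0.
pose phi : {rmorphism padic_int p_pr -> residue_field m_max} :=
  residue m_max \o padic_to_integers.
have [c Ec] := residue_surj (p%:R^-1 : residue_field m_max).
have [q q_mon q_c] : exists2 q : {poly padic_int p_pr}, q \is monic &
    root (map_poly phi q) (p%:R^-1).
  have /asboolP[q q_mon qc] : val c \in integers K by case: (c).
  exists q => //; rewrite map_poly_comp -Ec; apply: rmorph_root.
  apply/eqP/val_inj; rewrite rmorph0 -horner_map -map_poly_comp.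
  exact/eqP.
have lc : phi (lead_coef q) = 1 by rewrite (monicP q_mon) rmorph1.
pose d := (size q).-1; have szq : size (map_poly phi q) = d.+1.
  rewrite size_map_poly_id0 ?lc ?oner_neq0 // prednK // size_poly_gt0.
  exact: monic_neq0.
pose u : padic_int p_pr := 1 + p%:R * \sum_(i < d) q`_i * p%:R ^+ (d - i).-1.
have term i : (i <= d)%N ->
    p%:R ^+ d * ((map_poly phi q)`_i * p%:R^-1 ^+ i) = phi q`_i * p%:R ^+ (d - i).
  move=> id; rewrite coef_map mulrCA; congr (_ * _).
  by rewrite -[in LHS](subnK id) exprD exprVn mulfK ?expf_neq0.
have phi_u : phi u = 0.
  transitivity (p%:R ^+ d * (map_poly phi q).[p%:R^-1]); last first.
    by rewrite (eqP q_c) mulr0.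
  rewrite horner_coef szq mulr_sumr big_ord_recr term // subnn expr0 mulr1.
  have -> : phi q`_d = 1 by [].
  rewrite rmorphD rmorph1 rmorphM rmorph_nat rmorph_sum mulr_sumr addrC.
  congr (_ + _); apply: eq_bigr => i _.
  rewrite rmorphM rmorphXn rmorph_nat term; last exact: ltnW (ltn_ord i).
  by rewrite mulrCA -exprS prednK // subn_gt0.
have [|w uw] := @padic_int_unit _ _ u.
  rewrite padic_compD padic_comp1 padic_compM padic_comp_nat expn1.
  by rewrite modzz mul0r mod0z addr0 modz_mod modz_small //= ltz_nat prime_gt1.
move: (rmorph1 phi); rewrite -uw rmorphM phi_u mul0r => /esym/eqP.
by rewrite oner_eq0.
Qed.
End ResidueChar.

Lemma unity_root_integral (R K : comNzRingType) (phi : {rmorphism R -> K}) n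
    (z : K) :
  (0 < n)%N -> z ^+ n = 1 -> integralOver phi z.
Proof.
move=> n_gt0 zn; exists ('X^n - 1); first exact: monicXnsubC.
by rewrite rmorphB rmorph1 rmorphXn /= map_polyX rootE !hornerE zn subrr.
Qed.

Lemma integral_exp (R K : comNzRingType) (phi : {rmorphism R -> K}) (u : K)
    n :
  integralOver phi u -> integralOver phi (u ^+ n).
Proof.
move=> u_int; elim: n => [|n IHn]; first by rewrite expr0; apply: integral1.
by rewrite exprS; apply: integral_mul.
Qed.

(** Expand [(1 + y)^p = 1] with [y = z - 1]: the inner binomial coefficients are
    multiples of [p]. *)
Lemma unity_root_sub1_exp (R K : comNzRingType) (phi : {rmorphism R -> K}) p
    (z : K) :
    prime p -> z ^+ p = 1 ->
  exists2 c, integralOver phi c & (z - 1) ^+ p = p%:R * c.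
Proof.
move=> p_pr zp; have p_gt0 := prime_gt0 p_pr.
have y_int : integralOver phi (z - 1).
  by apply: integral_sub; [apply: unity_root_integral zp | apply: integral1].
move: (z - 1) (subrK 1 z) y_int => y Dz y_int.
exists (- \sum_(i < p.-1) ('C(p, i.+1) %/ p)%:R * y ^+ i.+1).
  apply: integral_opp; apply: (big_ind (integralOver phi)) => [|u w|i _].
  - exact: integral0.
  - exact: integral_add.
  - by apply: integral_mul; [apply: integral_nat | apply: integral_exp].
have := zp; rewrite -Dz addrC exprDn -(prednK p_gt0) big_ord_recl big_ord_recr.
rewrite /= !prednK // bin0 subn0 expr0 expr1n mulr1 mulr1n => /eqP.
rewrite -[X in _ == X]addr0 (inj_eq (addrI _)) /bump /= add1n prednK // subnn.
rewrite expr0 mul1r binn mulr1n addrC addr_eq0.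
move/eqP->; rewrite mulrN mulr_sumr; congr (- _); apply: eq_bigr => i _.
rewrite add1n expr1n mul1r mulrA -natrM mulnC divnK ?mulr_natl //.
by rewrite prime_dvd_bin //= -[X in (_ < X)%N](prednK p_gt0) ltnS ltn_ord.
Qed.

Lemma horner_map_sub1 (O L : comNzRingType) (f : {rmorphism O -> L})
    (q : {poly O}) (z : L) :
  exists r, (map_poly f q).[z] = (map_poly f r).[z] * (z - 1) + f q.[1].
Proof.
have /factor_theorem[r /(canRL (subrK _)) Dq] : root (q - q.[1]%:P) 1.
  by rewrite rootE hornerD hornerN hornerC subrr.
exists r; rewrite {1}Dq rmorphD rmorphM rmorphB /= map_polyX !map_polyC /=.
by rewrite !hornerE rmorph1.
Qed.

Section Specialization.
Variables (p : nat) (p_pr : prime p) (K : fieldExtType (padic p_pr)).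
Variables (m : {pred integer_ring K}) (m_max : maximal_ideal m).
Variables (L : fieldType) (h : {rmorphism K -> L}).

Local Notation O := (integer_ring K).
Local Notation emb := (padic_int_embed K).

Lemma integral_val (c : O) : integralOver (h \o emb) (h (val c)).
Proof. by apply: integral_rmorph; case: c => c /= /asboolP. Qed.

(** If [q(z) = 0], then [q(1)] is [z - 1] times an integral element, so its
    [p]-th power is [p] times an integral element, which lies in [K] and
    therefore in [O]. *)
Lemma residue_specialize (z : L) (q : {poly O}) :
    z ^+ p = 1 -> (map_poly (h \o val) q).[z] = 0 ->
  (map_poly (residue m_max) q).[1] = 0.
Proof.
pose hv : {rmorphism O -> L} := h \o val; rewrite -/(map_poly hv q).
move=> zp qz; rewrite -[1](rmorph1 (residue m_max)) horner_map /=.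
have [r] := horner_map_sub1 hv q z.
rewrite qz => /esym/eqP; rewrite addrC addr_eq0 -mulrN.
change (hv q.[1]) with (h (val q.[1])).
move: q.[1] => d /eqP Ed.
have r_int : integralOver (h \o emb) (map_poly hv r).[z].
  apply: integral_horner; last exact: unity_root_integral (prime_gt0 p_pr) zp.
  by apply/integral_poly => i; rewrite coef_map; exact: integral_val.
move: (_.[z]) r_int Ed => b b_int Ed.
have [c c_int zc] := unity_root_sub1_exp (h \o emb) p_pr zp.
have [w Dd] : exists w : O, d ^+ p = p%:R * w.
  have hdp : h (val d ^+ p) = p%:R * ((- b) ^+ p * c).
    by rewrite rmorphXn Ed mulrN -mulNr exprMn zc mulrCA.
  have [p0|p0] := eqVneq (p%:R : L) 0.
    exists 0; rewrite mulr0; apply: val_inj; apply: (fmorph_inj h).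
    by rewrite rmorphXn hdp p0 mul0r !rmorph0.
  have w_int : val d ^+ p / p%:R \in integers K.
    have : integralOver (h \o emb) (h (val d ^+ p / p%:R)).
      rewrite fmorph_div hdp rmorph_nat mulrAC mulfV // mul1r.
      by apply: integral_mul => //; apply/integral_exp/integral_opp.
    case=> s s_mon; rewrite map_poly_comp fmorph_root => sw.
    by apply/asboolP; exists s.
  exists (IntegerRing w_int); apply: val_inj.
  rewrite rmorphXn rmorphM rmorph_nat /= mulrC divfK //.
  by apply: contra_neq p0 => p0; rewrite -(rmorph_nat h) p0 rmorph0.
apply: contraTeq (prime_gt0 p_pr) => d_n0.
have : residue m_max d ^+ p = 0.
  by rewrite -rmorphXn Dd rmorphM rmorph_nat residue_char mul0r.
by move/eqP; rewrite expf_eq0 (negPf d_n0) andbF.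
Qed.
End Specialization.

(** The root of unity lies in an extension of [K]; the equality between elements
    of [K] descends from it. *)
Theorem integral_idempotent_trace (p : nat) (p_pr : prime p)
    (K : fieldExtType (padic p_pr)) (m : {pred integer_ring K})
    (m_max : maximal_ideal m) (T : finType) (x : {perm T}) (E : T -> T -> K) :
    p%:R != 0 :> K -> #[x]%g = p ->
    (forall u w, E u w \in integers K) ->
    (forall u w, E (x u) (x w) = E u w) ->
    (forall u w, \sum_c E u c * E c w = E u w) ->
  let F := fixed_vertices x in
  \sum_u E u (x u)
    = (\rank (set_mx F F (fun u w => reduce m_max (E u w))))%:R.
Proof.
move=> pK x_order E_int E_inv E_idem F.
have [L [z z_prim]] := exists_primitive_root_ext p_pr pK.
pose EO u w : integer_ring K := insubd 0 (E u w).
have valEO u w : val (EO u w) = E u w by rewrite insubdK.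
apply: (fmorph_inj (in_alg L)); rewrite rmorph_nat.
have EO_inv u w : EO (x u) (x w) = EO u w by rewrite /EO E_inv.
have EO_idem u w : \sum_c EO u c * EO c w = EO u w.
  apply: val_inj; rewrite rmorph_sum valEO -E_idem; apply: eq_bigr => c _.
  by rewrite -(valEO u c) -(valEO c w); exact: (rmorphM val).
have spec (y : L) (q : {poly integer_ring K}) :=
  @residue_specialize _ _ _ _ m_max _ (in_alg L) y q.
rewrite -(twisted_trace_eq_rank p_pr x_order spec EO_inv EO_idem z_prim
  (residue_char m_max)).
rewrite -[RHS]/(in_alg L (val (\sum_u EO u (x u)))); congr (in_alg L _).
by rewrite rmorph_sum; apply: eq_bigr => u _; rewrite -valEO.
Qed.

(** * The spectral idempotents of a strongly regular graph *)

Section StronglyRegular.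
Variables (T : finType) (e : rel T) (v k l mu : nat).
Hypothesis e_srg : strongly_regular e v k l mu.
Variable R : comNzRingType.

Local Notation A := (adjmx e R).
Local Notation J := (const_mx 1 : 'M[R]_#|T|).

Lemma sum_enum_val (V : nmodType) (f : T -> V) :
  \sum_(i < #|T|) f (enum_val i) = \sum_u f u.
Proof. by rewrite [RHS](big_enum_val f). Qed.

Lemma natr_card_set (P : pred T) : #|[set w | P w]|%:R = \sum_w (P w)%:R :> R.
Proof.
rewrite -sum1_card natr_sum big_mkcond; apply: eq_bigr => w _.
by rewrite inE; case: (P w).
Qed.

Lemma adjmx_all_one : A *m J = k%:R *: J.
Proof.
have [_ _ _ [deg _ _]] := e_srg.
apply/matrixP => i j; rewrite !mxE mulr1 -(deg (enum_val i)) natr_card_set.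
by rewrite -sum_enum_val; apply: eq_bigr => c _; rewrite !mxE mulr1.
Qed.

Lemma all_one_adjmx : J *m A = k%:R *: J.
Proof.
have [e_sym _ _ _] := e_srg.
have tA : A^T = A by apply/matrixP => i j; rewrite !mxE e_sym.
have tJ : J^T = J by apply/matrixP => i j; rewrite !mxE.
by rewrite -[LHS]trmxK trmx_mul tA tJ adjmx_all_one linearZ /= tJ.
Qed.

Lemma all_one_sqr : J *m J = v%:R *: J.
Proof.
have [_ _ Tv _] := e_srg.
apply/matrixP => i j; rewrite !mxE mulr1.
under eq_bigr do rewrite !mxE mulr1.
by rewrite sumr_const card_ord Tv.
Qed.

Lemma adjmx_sqr : A *m A = k%:R%:M + l%:R *: A + mu%:R *: (J - 1%:M - A).
Proof.
have [e_sym e_irr _ [deg adj nadj]] := e_srg.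
apply/matrixP => i j; rewrite !mxE.
have -> : \sum_c A i c * A c j
    = #|[set w | e (enum_val i) w && e (enum_val j) w]|%:R.
  rewrite natr_card_set -sum_enum_val; apply: eq_bigr => c _.
  by rewrite !mxE -natrM mulnb (e_sym (enum_val c)).
have [<-|ij] := eqVneq i j.
  rewrite e_irr (eq_card (B := [set w | e (enum_val i) w])) => [|w]; last first.
    by rewrite !inE andbb.
  by rewrite deg !mulr1n !mulr0n; ring.
have := nadj (enum_val i) (enum_val j); have := adj (enum_val i) (enum_val j).
rewrite (inj_eq enum_val_inj) ij !mulr0n.
by case: e => [/(_ isT) -> _|_ /(_ isT isT) ->]; rewrite ?(mulr1n, mulr0n); ring.
Qed.

Lemma adjmx_quadratic (th th' : R) :
    th + th' = l%:R - mu%:R -> th * th' = mu%:R - k%:R ->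
  (A - th%:M) *m (A - th'%:M) = mu%:R *: J.
Proof.
move=> Es Ep; rewrite mulmxBl !mulmxBr adjmx_sqr.
have -> : th'%:M = th' *: 1%:M :> 'M[R]_#|T| by rewrite scalemx1.
have -> : th%:M = th *: 1%:M :> 'M[R]_#|T| by rewrite scalemx1.
have -> : k%:R%:M = k%:R *: 1%:M :> 'M[R]_#|T| by rewrite scalemx1.
rewrite -!(scalemxAr, scalemxAl) mulmx1 !mul1mx.
apply/matrixP => i j; rewrite !mxE.
set d := (i == j)%:R; set a := (e _ _)%:R.
have -> : k%:R * d + l%:R * a + mu%:R * (1 - d - a) - th' * a
      - (th * a - th' * (th * d))
    = mu%:R * 1 + (l%:R - mu%:R - (th + th')) * a
      + (th * th' - (mu%:R - k%:R)) * d by ring.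
by rewrite Es Ep !subrr !mul0r !addr0.
Qed.

(** The degree [k] is the eigenvalue of [A] on the all-one vector, on which [J]
    has the eigenvalue [v]. *)
Lemma principal_eigenvalue (th th' : R) :
    th + th' = l%:R - mu%:R -> th * th' = mu%:R - k%:R -> (0 < v)%N ->
  (k%:R - th) * (k%:R - th') = mu%:R * v%:R.
Proof.
move=> Es Ep v_gt0; have [_ _ Tv _] := e_srg.
have AJ c : (A - c%:M) *m J = (k%:R - c) *: J.
  by rewrite mulmxBl adjmx_all_one mul_scalar_mx scalerBl.
have := congr1 (mulmx^~ J) (adjmx_quadratic Es Ep).
rewrite -mulmxA AJ -scalemxAr AJ -scalemxAl all_one_sqr !scalerA mulrC.
have i : 'I_#|T| by rewrite Tv; exact: Ordinal v_gt0.
by move/matrixP/(_ i i); rewrite !mxE !mulr1.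
Qed.
End StronglyRegular.

(** With [B] the unnormalized idempotent, [B J = 0], so that [B^2] is
    [B (A - th')], which the quadratic equation of [A] reduces to
    [(th - th') B].  For [th = th'] the scaling by the inverse of [0] makes the
    matrix zero. *)
Lemma srg_idempotent_idempotent (T : finType) (e : rel T) (v k l mu : nat)
    (th th' : algC) :
    strongly_regular e v k l mu -> (0 < v)%N ->
    th + th' = l%:R - mu%:R -> th * th' = mu%:R - k%:R ->
  srg_idempotent e v k th th' *m srg_idempotent e v k th th'
    = srg_idempotent e v k th th'.
Proof.
move=> e_srg v_gt0 Es Ep; set g := (k%:R - th') / v%:R.
have v_n0 : v%:R != 0 :> algC by rewrite pnatr_eq0 -lt0n.
have gv : g * v%:R = k%:R - th' by rewrite divfK.
have mu_g : mu%:R = g * (k%:R - th).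
  apply: (mulIf v_n0); rewrite mulrAC gv.
  by rewrite -(principal_eigenvalue e_srg Es Ep) // mulrC.
pose A := adjmx e algC; pose J : 'M[algC]_#|T| := const_mx 1.
have DJ c : const_mx c = c *: J by apply/matrixP => i j; rewrite !mxE mulr1.
pose B := A - th'%:M - g *: J.
have BJ : B *m J = 0.
  rewrite !mulmxBl (adjmx_all_one e_srg) mul_scalar_mx -scalemxAl.
  by rewrite (all_one_sqr e_srg) -scalerBl scalerA gv subrr.
have JA : J *m (A - th'%:M) = (k%:R - th') *: J.
  by rewrite mulmxBr (all_one_adjmx e_srg) mul_mx_scalar scalerBl.
have AA : (A - th'%:M) *m (A - th'%:M) = mu%:R *: J + (th - th') *: (A - th'%:M).
  rewrite -(adjmx_quadratic e_srg Es Ep) -mul_scalar_mx -mulmxDl; congr (_ *m _).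
  by rewrite raddfB /= addrA subrK.
have BB : B *m B = (th - th') *: B.
  transitivity (B *m (A - th'%:M)).
    by rewrite [RHS]/= {2}/B mulmxBr -scalemxAr BJ scaler0 subr0.
  rewrite /B mulmxBl AA -scalemxAl JA [RHS]scalerBr !scalerA addrAC addrC.
  by rewrite -scalerBl mu_g -scaleNr; congr (_ + _ *: _); ring.
rewrite /srg_idempotent DJ -/A -/g -/B -scalemxAl -scalemxAr BB !scalerA.
congr (_ *: _); have [->|D0] := eqVneq (th - th') 0.
  by rewrite invr0 !mul0r.
by rewrite mulfVK.
Qed.

Lemma srg_eigenvalues (k l mu : nat) (th th' : algC) :
    th = srg_r k l mu /\ th' = srg_s k l mu \/
    th = srg_s k l mu /\ th' = srg_r k l mu ->
  th + th' = l%:R - mu%:R /\ th * th' = mu%:R - k%:R.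
Proof.
set q := l%:R - mu%:R : algC.
have Es : srg_r k l mu + srg_s k l mu = q.
  by rewrite /srg_r /srg_s -/q; field.
have Ep : srg_r k l mu * srg_s k l mu = mu%:R - k%:R.
  rewrite /srg_r /srg_s -/q; set d := sqrtC _.
  have -> : (q + d) / 2 * ((q - d) / 2) = (q ^+ 2 - d ^+ 2) / 4 by field.
  by rewrite sqrtCK /srg_discr -/q; field.
by case=> -[-> ->]; rewrite ?[_ s + _]addrC // addrC mulrC.
Qed.

Theorem proposition4p4
  (T : finType) (e : rel T) (v k l mu : nat)
  (e_srg : strongly_regular e v k l mu)
  (e_conn : connected_graph e)
  (e_ncomp : ~ complete_graph e)
  (p : nat) (p_pr : prime p)
  (x : {perm T}) (x_aut : graph_automorphism e x) (x_order : #[x]%g = p)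
  (theta theta' : algC)
  (theta_rs : theta = srg_r k l mu /\ theta' = srg_s k l mu \/
              theta = srg_s k l mu /\ theta' = srg_r k l mu)
  (* L is the field Q(theta), with its inclusion into the complex numbers *)
  (L : fieldExtType rat) (LtoC : {rmorphism L -> algC}) (t : L)
  (t_theta : LtoC t = theta) (t_gen : <<1; t>>%VS = fullv)
  (alpha beta gamma : L)
  (E_def : srg_idempotent e v k theta theta' =
    bose_mesner_mx e (LtoC alpha) (LtoC beta) (LtoC gamma))
  (K : fieldExtType (padic p_pr)) (iota : {rmorphism L -> K})
  (m : {pred integer_ring K}) (m_max : maximal_ideal m)
  (E_lattice : preserves_lattice
    (bose_mesner_mx e (iota alpha) (iota beta) (iota gamma))) :
  let F := fixed_vertices x in
  iota alpha * #|F|%:R + iota beta * #|moved_to_neighbour e x|%:R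
    + iota gamma * v%:R
  = (\rank (map_mx (reduce m_max)
       (iota alpha *: principal_submx F 1%:M
        + iota beta *: principal_submx F (adjmx e K)
        + iota gamma *: principal_submx F (const_mx 1))))%:R.
Proof.
move=> F.
have v_gt0 : (0 < v)%N.
  have [_ _ <- _] := e_srg; rewrite lt0n; apply: contra_notN e_ncomp.
  by move=> /eqP/card0_eq T0 u; have := T0 u; rewrite inE.
pose M := bose_mesner_mx e (iota alpha) (iota beta) (iota gamma).
have map_bm (S S' : fieldType) (f : {rmorphism S -> S'}) a b c :
    map_mx f (bose_mesner_mx e a b c) = bose_mesner_mx e (f a) (f b) (f c).
  by apply/matrixP => i j; rewrite !mxE !rmorphD !rmorphM !rmorph_nat rmorph1.
have M_idem : M *m M = M.
  have [Es Ep] := srg_eigenvalues theta_rs.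
  rewrite /M -map_bm -map_mxM; congr map_mx; apply: (map_mx_inj (f := LtoC)).
  by rewrite map_mxM map_bm -E_def (srg_idempotent_idempotent e_srg).
have M_int i j : M i j \in integers K.
  have := E_lattice (delta_mx j 0); rewrite -/M -colE => /(_ _ i); rewrite !mxE.
  by apply=> c; rewrite mxE rpred_nat.
pose E u w := M (enum_rank u) (enum_rank w).
have EE u w :
    E u w = iota alpha * (u == w)%:R + iota beta * (e u w)%:R + iota gamma.
  by rewrite /E !mxE !enum_rankK (inj_eq enum_rank_inj) mulr1.
have E_inv u w : E (x u) (x w) = E u w.
  by rewrite !EE (inj_eq perm_inj) x_aut.
have E_idem u w : \sum_c E u c * E c w = E u w.
  rewrite /E -[in RHS]M_idem mxE.
  by rewrite [RHS](reindex (@enum_rank T)) //; apply/onW_bij/enum_rank_bij.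
have pK : p%:R != 0 :> K.
  rewrite -(rmorph_nat iota) fmorph_eq0 -(fmorph_eq0 LtoC) rmorph_nat.
  by rewrite pnatr_eq0 -lt0n prime_gt0.
have := integral_idempotent_trace m_max pK x_order (fun u w => M_int _ _)
  E_inv E_idem.
rewrite -/F /=.
have -> : \sum_u E u (x u) = iota alpha * #|F|%:R
    + iota beta * #|moved_to_neighbour e x|%:R + iota gamma * v%:R.
  under eq_bigr do rewrite EE.
  rewrite !big_split /= -!mulr_sumr /F /fixed_vertices /moved_to_neighbour.
  rewrite !natr_card_set.
  congr (_ * _ + _ + _); first by apply: eq_bigr => u _; rewrite eq_sym.
  by have [_ _ <- _] := e_srg; rewrite sumr_const mulr_natr.
move=> ->; congr (\rank _)%:R; apply/matrixP => i j; rewrite !mxE; congr reduce.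
Qed.
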